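(* Let $\Omega$ be an extended diassociative semigroup (EDS), and $V$ a vector space over a field $\mathbb{K}$. For any $k,l\geq1$, any $\alpha_2,\ldots,\alpha_{k+l}\in\Omega$ and any $v_1,\ldots,v_{k+l}\in V$, in $\mathrm{Sh}^+_\Omega(V)$: $$(\alpha_2\ldots\alpha_k\otimes v_1\ldots v_k)\prec_{\alpha_{k+1}}(\alpha_{k+2}\ldots\alpha_{k+l}\otimes v_{k+1}\ldots v_{k+l})=\sum_{\sigma\in\mathbf{sh}_\prec(k,l)}D^{k,l}_\sigma(\alpha_2,\ldots,\alpha_{k+l})\otimes v_{\sigma^{-1}(1)}\ldots v_{\sigma^{-1}(k+l)},$$ $$(\alpha_2\ldots\alpha_k\otimes v_1\ldots v_k)\succ_{\alpha_{k+1}}(\alpha_{k+2}\ldots\alpha_{k+l}\otimes v_{k+1}\ldots v_{k+l})=\sum_{\sigma\in\mathbf{sh}_\succ(k,l)}D^{k,l}_\sigma(\alpha_2,\ldots,\alpha_{k+l})\otimes v_{\sigma^{-1}(1)}\ldots v_{\sigma^{-1}(k+l)}.$$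
   Context: Extended diassociative semigroups. A diassociative semigroup is a set $\Omega$ with maps $\leftarrow,\rightarrow:\Omega\times\Omega\to\Omega$ such that for all $\alpha,\beta,\gamma\in\Omega$: $(\alpha\leftarrow\beta)\leftarrow\gamma=\alpha\leftarrow(\beta\leftarrow\gamma)=\alpha\leftarrow(\beta\rightarrow\gamma)$; $(\alpha\rightarrow\beta)\leftarrow\gamma=\alpha\rightarrow(\beta\leftarrow\gamma)$; $(\alpha\rightarrow\beta)\rightarrow\gamma=(\alpha\leftarrow\beta)\rightarrow\gamma=\alpha\rightarrow(\beta\rightarrow\gamma)$. An extended diassociative semigroup (EDS) is $(\Omega,\leftarrow,\rightarrow,\triangleleft,\triangleright)$ such that $(\Omega,\leftarrow,\rightarrow)$ is a diassociative semigroup and for all $\alpha,\beta,\gamma\in\Omega$: $\alpha\triangleright(\beta\leftarrow\gamma)=\alpha\triangleright\beta$; $(\alpha\rightarrow\beta)\triangleleft\gamma=\beta\triangleleft\gamma$; $(\alpha\triangleleft\beta)\leftarrow((\alpha\leftarrow\beta)\triangleleft\gamma)=\alpha\triangleleft(\beta\leftarrow\gamma)$; $(\alpha\triangleleft\beta)\triangleleft((\alpha\leftarrow\beta)\triangleleft\gamma)=\beta\triangleleft\gamma$; $(\alpha\triangleleft\beta)\rightarrow((\alpha\leftarrow\beta)\triangleleft\gamma)=\alpha\triangleleft(\beta\rightarrow\gamma)$; $(\alpha\triangleleft\beta)\triangleright((\alpha\leftarrow\beta)\triangleleft\gamma)=\beta\triangleright\gamma$; $(\alpha\triangleright(\beta\rightarrow\gamma))\leftarrow(\beta\triangleright\gamma)=(\alpha\leftarrow\beta)\triangleright\gamma$;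 $(\alpha\triangleright(\beta\rightarrow\gamma))\triangleleft(\beta\triangleright\gamma)=\alpha\triangleleft\beta$; $(\alpha\triangleright(\beta\rightarrow\gamma))\rightarrow(\beta\triangleright\gamma)=(\alpha\rightarrow\beta)\triangleright\gamma$; $(\alpha\triangleright(\beta\rightarrow\gamma))\triangleright(\beta\triangleright\gamma)=\alpha\triangleright\beta$. Typed words. $\mathrm{Sh}^+_\Omega(V)=\bigoplus_{n\geq1}(\mathbb{K}\Omega)^{\otimes(n-1)}\otimes V^{\otimes n}$, spanned by typed words $\alpha_2\ldots\alpha_n\otimes v_1\ldots v_n$ (tuples in $\Omega^{n-1}$ are identified with tensors in $(\mathbb{K}\Omega)^{\otimes(n-1)}$). For $\alpha\in\Omega$, $v\in V$, put $(\alpha\otimes v)\cdot(\alpha_2\ldots\alpha_n\otimes v_1\ldots v_n)=\alpha\alpha_2\ldots\alpha_n\otimes vv_1\ldots v_n$. Each typed word of length $\ge2$ is of the form $(\beta\otimes v)\cdot x'$. The bilinear products are defined recursively, for typed words $x,y$ and $v,w\in V$, by: $v\prec_\alpha y=(\alpha\otimes v)\cdot y$; $x\succ_\alpha w=(\alpha\otimes w)\cdot x$; if $x=(\beta\otimes v)\cdot x'$, $x\prec_\alpha y=((\beta\leftarrow\alpha)\otimes v)\cdot(x'\prec_{\beta\triangleleft\alpha}y)+((\beta\rightarrow\alpha)\otimes v)\cdot(x'\succ_{\beta\triangleright\alpha}y)$; if $y=(\beta\otimes w)\cdot y'$, $x\succ_\alpha y=((\alpha\leftarrow\beta)\otimes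 w)\cdot(x\prec_{\alpha\triangleleft\beta}y')+((\alpha\rightarrow\beta)\otimes w)\cdot(x\succ_{\alpha\triangleright\beta}y')$. Shuffles. $\mathbf{sh}(k,l)$ is the set of $\sigma\in\mathfrak{S}_{k+l}$ with $\sigma(1)<\ldots<\sigma(k)$ and $\sigma(k+1)<\ldots<\sigma(k+l)$; $\mathbf{sh}_\prec(k,l)$ (resp. $\mathbf{sh}_\succ(k,l)$) is the subset where $\sigma^{-1}(1)=1$ (resp. $\sigma^{-1}(1)=k+1$), for $k,l\ge1$. Permutations are written as words $(\sigma(1),\ldots,\sigma(n))$. Maps $D^{k,l}_\sigma:\Omega^{k+l-1}\to\Omega^{k+l-1}$ for $\sigma\in\mathbf{sh}(k,l)$, $k,l\ge1$, defined recursively: (i) if $\sigma\in\mathbf{sh}_\prec(1,l)$, $D^{1,l}_\sigma(\alpha_2,\ldots,\alpha_{l+1})=(\alpha_2,\ldots,\alpha_{l+1})$. (ii) If $\sigma\in\mathbf{sh}_\prec(k,l)$, $k\geq2$, let $\sigma'=(\sigma(2)-1,\ldots,\sigma(k+l)-1)\in\mathbf{sh}(k-1,l)$; then $D^{k,l}_\sigma(\alpha_2,\ldots,\alpha_{k+l})$ is $(\alpha_2\leftarrow\alpha_{k+1},D^{k-1,l}_{\sigma'}(\alpha_3,\ldots,\alpha_k,\alpha_2\triangleleft\alpha_{k+1},\alpha_{k+2},\ldots,\alpha_{k+l}))$ if $\sigma'\in\mathbf{sh}_\prec(k-1,l)$, and $(\alpha_2\rightarrow\alpha_{k+1},D^{k-1,l}_{\sigma'}(\alpha_3,\ldots,\alpha_k,\alpha_2\triangleright\alpha_{k+1},\alpha_{k+2},\ldots,\alpha_{k+l}))$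 if $\sigma'\in\mathbf{sh}_\succ(k-1,l)$. (iii) If $\sigma\in\mathbf{sh}_\succ(k,1)$, $D^{k,1}_\sigma(\alpha_2,\ldots,\alpha_{k+1})=(\alpha_{k+1},\alpha_2,\ldots,\alpha_k)$. (iv) If $\sigma\in\mathbf{sh}_\succ(k,l)$, $l\ge2$, let $\sigma'=(\sigma(1)-1,\ldots,\sigma(k)-1,\sigma(k+2)-1,\ldots,\sigma(k+l)-1)\in\mathbf{sh}(k,l-1)$; then $D^{k,l}_\sigma(\alpha_2,\ldots,\alpha_{k+l})$ is $(\alpha_{k+1}\leftarrow\alpha_{k+2},D^{k,l-1}_{\sigma'}(\alpha_2,\ldots,\alpha_k,\alpha_{k+1}\triangleleft\alpha_{k+2},\alpha_{k+3},\ldots,\alpha_{k+l}))$ if $\sigma'\in\mathbf{sh}_\prec(k,l-1)$, and $(\alpha_{k+1}\rightarrow\alpha_{k+2},D^{k,l-1}_{\sigma'}(\alpha_2,\ldots,\alpha_k,\alpha_{k+1}\triangleright\alpha_{k+2},\alpha_{k+3},\ldots,\alpha_{k+l}))$ if $\sigma'\in\mathbf{sh}_\succ(k,l-1)$. *)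

(* Defs.v *)
From HB Require Import structures.
From mathcomp Require Import all_boot all_fingroup all_algebra.
From mathcomp Require Import generic_quotient ring_quotient boolp finmap monalg.

Set Implicit Arguments.
Unset Strict Implicit.
Unset Printing Implicit Defensive.

Import GRing.Theory.
Local Open Scope ring_scope.
Local Open Scope quotient_scope.

Declare Scope eds_scope.
Delimit Scope eds_scope with eds.

HB.mixin Record isDiassociativeSemigroup T := {
  dleft : T -> T -> T;
  dright : T -> T -> T;
  dleftA : forall a b c, dleft (dleft a b) c = dleft a (dleft b c);
  dleft_dright : forall a b c, dleft a (dleft b c) = dleft a (dright b c);
  drightlA : forall a b c, dleft (dright a b) c = dright a (dleft b c);
  dright_dleft : forall a b c, dright (dright a b) c = dright (dleft a b) c;
  drightA : forall a b c, dright (dleft a b) c = dright a (dright b c)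
}.

#[short(type="diassociativeSemigroupType")]
HB.structure Definition DiassociativeSemigroup :=
  {T of Choice T & isDiassociativeSemigroup T}.

Notation "a ← b" := (dleft a b) (at level 40, no associativity) : eds_scope.
Notation "a → b" := (dright a b) (at level 40, no associativity) : eds_scope.

HB.mixin Record isExtendedDiassociativeSemigroup T
    of DiassociativeSemigroup T := {
  tleft : T -> T -> T;
  tright : T -> T -> T;
  tright_dleft : forall a b c : T, tright a (b ← c)%eds = tright a b;
  dright_tleft : forall a b c : T, tleft (a → b)%eds c = tleft b c;
  tleft_dleft_tleft : forall a b c : T,
    (tleft a b ← tleft (a ← b) c)%eds = tleft a (b ← c)%eds;
  tleft_tleft_tleft : forall a b c : T,
    tleft (tleft a b) (tleft (a ← b)%eds c) = tleft b c;
  tleft_dright_tleft : forall a b c : T,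
    (tleft a b → tleft (a ← b) c)%eds = tleft a (b → c)%eds;
  tleft_tright_tleft : forall a b c : T,
    tright (tleft a b) (tleft (a ← b)%eds c) = tright b c;
  tright_dleft_tright : forall a b c : T,
    (tright a (b → c) ← tright b c)%eds = tright (a ← b)%eds c;
  tright_tleft_tright : forall a b c : T,
    tleft (tright a (b → c)%eds) (tright b c) = tleft a b;
  tright_dright_tright : forall a b c : T,
    (tright a (b → c) → tright b c)%eds = tright (a → b)%eds c;
  tright_tright_tright : forall a b c : T,
    tright (tright a (b → c)%eds) (tright b c) = tright a b
}.

#[short(type="edsType")]
HB.structure Definition ExtendedDiassociativeSemigroup :=
  {T of DiassociativeSemigroup T & isExtendedDiassociativeSemigroup T}.

Notation "a ◁ b" := (tleft a b) (at level 40, no associativity) : eds_scope.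
Notation "a ▷ b" := (tright a b) (at level 40, no associativity) : eds_scope.

Section LinearExtension.
Variables (K : fieldType) (T : choiceType) (M : lmodType K) (f : T -> M).

Definition linext (x : {malg K[T]}) : M := \sum_(t <- msupp x) x@_t *: f t.

Lemma linextw (d : {fset T}) (x : {malg K[T]}) :
  (msupp x `<=` d)%fset -> linext x = \sum_(t <- d) x@_t *: f t.
Proof.
move=> sxd; rewrite /linext (big_fset_incl _ sxd) // => t _ tNx.
by rewrite mcoeff_outdom // scale0r.
Qed.

Lemma linext_is_linear : linear linext.
Proof.
move=> c x y; pose d := (msupp x `|` msupp y `|` msupp (c *: x + y))%fset.
have dE t : t \in d = [|| t \in msupp x, t \in msupp y | t \in msupp (c *: x + y)].
  by rewrite !in_fsetU orbA.
rewrite (@linextw d) ?(@linextw d x) ?(@linextw d y).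
- rewrite scaler_sumr -big_split /=; apply: eq_bigr => t _.
  by rewrite mcoeffD mcoeffZ scalerDl scalerA.
- by apply/fsubsetP => t; rewrite dE => ->; rewrite !orbT.
- by apply/fsubsetP => t; rewrite dE => ->.
- by apply/fsubsetP => t; rewrite dE => ->; rewrite !orbT.
Qed.

HB.instance Definition _ :=
  GRing.isLinear.Build K {malg K[T]} M *:%R linext linext_is_linear.

Lemma linextU t : linext << t >> = f t.
Proof.
rewrite (@linextw [fset t]%fset) ?msuppU_le // big_seq_fset1.
by rewrite mcoeffUU scale1r.
Qed.

End LinearExtension.

Lemma linext_lin (K : fieldType) (T : choiceType) (M : lmodType K) c
    (f g h : T -> M) :
  (forall t, f t = c *: g t + h t) ->
  forall x, linext f x = c *: linext g x + linext h x.
Proof.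
move=> fgh x; rewrite scaler_sumr -big_split; apply: eq_bigr => t _ /=.
by rewrite fgh scalerDr !scalerA mulrC.
Qed.

(* The typed word α_2…α_n ⊗ v_1…v_n is encoded by the pair of
   [:: (α_2, v_1); …; (α_n, v_(n-1))] and v_n; prefixing by (α ⊗ v)· is then
   consing (α, v). *)
Definition word (Omega V : Type) : Type := (seq (Omega * V) * V)%type.

HB.instance Definition _ (Omega V : choiceType) := Choice.on (word Omega V).

Definition wdot (Omega V : Type) (a : Omega) (v : V) (w : word Omega V) :
  word Omega V := ((a, v) :: w.1, w.2).

Section ShPlus.
Variables (K : fieldType) (Omega : choiceType) (V : lmodType K).

Definition multilinear (M : lmodType K) (f : word Omega V -> M) : Prop :=
  (forall s a t z c u v, f (s ++ (a, c *: u + v) :: t, z) =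
     c *: f (s ++ (a, u) :: t, z) + f (s ++ (a, v) :: t, z)) /\
  (forall s c u v, f (s, c *: u + v) = c *: f (s, u) + f (s, v)).

(* The submodule of the free module on typed words spanned by the relations
   that make typed words multilinear in their letters v_i. *)
Inductive mlrel : {malg K[word Omega V]} -> Prop :=
| mlrel0 : mlrel 0
| mlrelDZ c x y : mlrel x -> mlrel y -> mlrel (c *: x + y)
| mlrel_mid s a t z c u v :
    mlrel (<< (s ++ (a, c *: u + v) :: t, z) : word Omega V >>
       - (c *: << (s ++ (a, u) :: t, z) : word Omega V >>
          + << (s ++ (a, v) :: t, z) : word Omega V >>))
| mlrel_last s c u v :
    mlrel (<< (s, c *: u + v) : word Omega V >>
       - (c *: << (s, u) : word Omega V >> + << (s, v) : word Omega V >>)).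

Definition mlrelp : {pred {malg K[word Omega V]}} := fun x => `[< mlrel x >].

Lemma mlrelp_zmod_closed : zmod_closed mlrelp.
Proof.
split=> [|x y /asboolP xr /asboolP yr]; apply/asboolP; first exact: mlrel0.
by rewrite addrC -scaleN1r; apply: mlrelDZ.
Qed.

HB.instance Definition _ := GRing.isZmodClosed.Build _ mlrelp mlrelp_zmod_closed.

Lemma mlrelpZ c x : x \in mlrelp -> c *: x \in mlrelp.
Proof.
move=> /asboolP xr; apply/asboolP; rewrite -[c *: x]addr0.
exact/mlrelDZ/mlrel0.
Qed.

(* ⊕_(n ≥ 1) (K Omega)^⊗(n-1) ⊗ V^⊗n: as (K Omega)^⊗(n-1) is free on
   Omega^(n-1), the summands are the tensor powers V^⊗n, one copy for each
   element of Omega^(n-1), and each of these is presented by generators v_1…v_n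
   and multilinearity relations. *)
Definition ShPlus : Type := Quotient.quot mlrelp.

HB.instance Definition _ := GRing.Zmodule.on ShPlus.

Definition shpi (x : {malg K[word Omega V]}) : ShPlus := \pi_(Quotient.quot mlrelp) x.


Lemma shpi_eq x y : x - y \in mlrelp -> shpi x = shpi y.
Proof. by rewrite Quotient.idealrBE => /eqP. Qed.

Lemma shpiK (x : ShPlus) : shpi (repr x) = x.
Proof. exact: reprK. Qed.

Lemma reprpi x : repr (shpi x) - x \in mlrelp.
Proof. by rewrite Quotient.idealrBE; apply/eqP; rewrite reprK. Qed.

Definition shscale (c : K) (x : ShPlus) : ShPlus := shpi (c *: repr x).

Lemma shpiZ c x : shscale c (shpi x) = shpi (c *: x).
Proof. by apply: shpi_eq; rewrite -scalerBr mlrelpZ ?reprpi. Qed.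

Lemma shpiD : {morph shpi : x y / x + y}.
Proof. exact: raddfD. Qed.

Fact shscaleA a b x : shscale a (shscale b x) = shscale (a * b) x.
Proof. by rewrite -(shpiK x) !shpiZ scalerA. Qed.
Fact shscale1 : left_id 1 shscale.
Proof. by move=> x; rewrite -(shpiK x) shpiZ scale1r. Qed.
Fact shscaleDr : right_distributive shscale +%R.
Proof.
move=> a x y; rewrite -(shpiK x) -(shpiK y) -shpiD !shpiZ -shpiD.
by rewrite scalerDr.
Qed.
Fact shscaleDl x : {morph shscale^~ x : a b / a + b}.
Proof. by move=> a b; rewrite -(shpiK x) !shpiZ -shpiD scalerDl. Qed.

HB.instance Definition _ := GRing.Zmodule_isLmodule.Build K ShPlus
  shscaleA shscale1 shscaleDr shscaleDl.

Fact shpi_is_linear : linear shpi.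
Proof. by move=> c x y; rewrite shpiD -shpiZ. Qed.

HB.instance Definition _ := GRing.isLinear.Build
  K {malg K[word Omega V]} ShPlus *:%R shpi shpi_is_linear.

Definition shword (w : word Omega V) : ShPlus := shpi << w >>.

Lemma shword_multilinear : multilinear shword.
Proof.
split=> [s a t z c u v|s c u v]; rewrite /shword -linearP; apply/shpi_eq/asboolP.
  exact: mlrel_mid.
exact: mlrel_last.
Qed.

Section Lift.
Variables (M : lmodType K) (f : word Omega V -> M).

(* The linear extension of f to ShPlus; meaningful for multilinear f only. *)
Definition shlift (x : ShPlus) : M := linext f (repr x).

Hypothesis fml : multilinear f.

Lemma linext_mlrel x : x \in mlrelp -> linext f x = 0.
Proof.
case: fml => fmid flast /asboolP; elim=> [|c y z _ y0 _ z0|*|*].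
- exact: linear0.
- by rewrite linearP /= y0 z0 scaler0 addr0.
- by rewrite linearB linearP /= !linextU fmid subrr.
- by rewrite linearB linearP /= !linextU flast subrr.
Qed.

Lemma shlift_pi x : shlift (shpi x) = linext f x.
Proof.
by apply/eqP; rewrite -subr_eq0 -linearB /= linext_mlrel ?reprpi.
Qed.

Lemma shlift_word w : shlift (shword w) = f w.
Proof. by rewrite shlift_pi linextU. Qed.

Lemma shlift_is_linear : linear shlift.
Proof.
move=> c x y; rewrite -(shpiK x) -(shpiK y) -[c *: _ + _]linearP !shlift_pi.
exact: linearP.
Qed.

End Lift.

Lemma sh_ind (P : ShPlus -> Prop) :
  P 0 -> (forall c x y, P x -> P y -> P (c *: x + y)) ->
  (forall w, P (shword w)) -> forall x, P x.
Proof.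
move=> P0 PD Pw x; rewrite -(shpiK x); move: (repr x) => {}x.
rewrite [x]monalgE raddf_sum /=; elim/big_ind: _ => [//|y z Py Pz|w _].
  by rewrite -[y]scale1r; apply: PD.
have -> : << x@_w *g w >> = x@_w *: << w >> :> {malg K[word Omega V]}.
  by apply/malgP => k; rewrite mcoeffZ !mcoeffU mulrnAr mulr1.
by rewrite -shpiZ -[shscale _ _]addr0; apply: PD; first exact: Pw.
Qed.

Inductive wlin (c : K) : word Omega V -> word Omega V -> word Omega V -> Prop :=
| wlin_last u v : wlin c ([::], c *: u + v) ([::], u) ([::], v)
| wlin_head a s z u v :
    wlin c ((a, c *: u + v) :: s, z) ((a, u) :: s, z) ((a, v) :: s, z)
| wlin_cons p s z s1 z1 s2 z2 : wlin c (s, z) (s1, z1) (s2, z2) ->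
    wlin c (p :: s, z) (p :: s1, z1) (p :: s2, z2).

Lemma multilinearP (M : lmodType K) (f : word Omega V -> M) :
  multilinear f <-> forall c x x1 x2, wlin c x x1 x2 -> f x = c *: f x1 + f x2.
Proof.
split=> [fml c x x1 x2 xl|fl].
  elim: xl f fml => [u v|a s z u v|p s z s1 z1 s2 z2 _ IHx] f [fm fl].
  - exact: fl.
  - exact: (fm [::]).
  - apply: (IHx (fun w => f (p :: w.1, w.2))); split=> *; last exact: fl.
    exact: (fm (_ :: _)).
split=> [s a t z c u v|s c u v]; apply: fl; elim: s => [|p s IHs];
  by constructor.
Qed.

Definition shletter (v : V) : ShPlus := shword ([::], v).

Definition shdot (a : Omega) (v : V) : ShPlus -> ShPlus :=
  shlift (fun w => shword (wdot a v w)).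

Lemma shdot_multilinear a v : multilinear (fun w => shword (wdot a v w)).
Proof.
case: shword_multilinear => wm wl; split=> *; last exact: wl.
exact: (wm (_ :: _)).
Qed.

Lemma shdot_word a v w : shdot a v (shword w) = shword (wdot a v w).
Proof. exact/shlift_word/shdot_multilinear. Qed.

Lemma shdot_is_linear a v : linear (shdot a v).
Proof. exact/shlift_is_linear/shdot_multilinear. Qed.

HB.instance Definition _ a v := GRing.isLinear.Build
  K ShPlus ShPlus *:%R (shdot a v) (shdot_is_linear a v).

Lemma shdot_linear_l a x : linear (shdot a ^~ x).
Proof.
move=> c u v; apply: linext_lin => w.
exact: (shword_multilinear.1 [::]).
Qed.

End ShPlus.

Arguments ShPlus {K} Omega V.
Arguments shword {K Omega V} w.
Arguments shletter {K} Omega {V} v.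

Section Products.
Variables (K : fieldType) (Omega : edsType) (V : lmodType K).
Local Notation Sh := (ShPlus Omega V).
Local Open Scope eds_scope.

(* The pair of the products of index a of the typed words (s, u) and (t, z). *)
Fixpoint wprod (s : seq (Omega * V)) (u : V) :=
  fix wprod_s (t : seq (Omega * V)) (z : V) (a : Omega) {struct t} : Sh * Sh :=
  (if s is (b, v) :: s' then
     shdot (b ← a) v (wprod s' u t z (b ◁ a)).1
       + shdot (b → a) v (wprod s' u t z (b ▷ a)).2
   else shdot a u (shword (t, z)),
   if t is (b, w) :: t' then
     shdot (a ← b) w (wprod_s t' z (a ◁ b)).1
       + shdot (a → b) w (wprod_s t' z (a ▷ b)).2
   else shdot a z (shword (s, u))).

Definition wprec (a : Omega) (x y : word Omega V) : Sh :=
  (wprod x.1 x.2 y.1 y.2 a).1.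
Definition wsucc (a : Omega) (x y : word Omega V) : Sh :=
  (wprod x.1 x.2 y.1 y.2 a).2.

Lemma wprec_letter a v y : wprec a ([::], v) y = shdot a v (shword y).
Proof. by case: y => -[|[b w] t] z. Qed.

Lemma wsucc_letter a x w : wsucc a x ([::], w) = shdot a w (shword x).
Proof. by case: x => -[|[b v] s] u. Qed.

Lemma wprec_dot a b v x y : wprec a (wdot b v x) y =
  shdot (b ← a) v (wprec (b ◁ a) x y) + shdot (b → a) v (wsucc (b ▷ a) x y).
Proof. by case: y => -[|[c w] t] z. Qed.

Lemma wsucc_dot a b w x y : wsucc a x (wdot b w y) =
  shdot (a ← b) w (wprec (a ◁ b) x y) + shdot (a → b) w (wsucc (a ▷ b) x y).
Proof. by case: x => -[|[c v] s] u. Qed.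

Lemma wlin_shword c (x x1 x2 : word Omega V) : wlin c x x1 x2 ->
  shword x = c *: shword x1 + shword x2.
Proof. by move: c x x1 x2; apply/multilinearP/shword_multilinear. Qed.

Lemma shdotD2 c a b v w (x x' y y' : Sh) :
  shdot a v (c *: x + x') + shdot b w (c *: y + y') =
  c *: (shdot a v x + shdot b w y) + (shdot a v x' + shdot b w y').
Proof. by rewrite !shdot_is_linear scalerDr addrACA. Qed.

Lemma shdotD2l c a b u v (x y : Sh) :
  shdot a (c *: u + v) x + shdot b (c *: u + v) y =
  c *: (shdot a u x + shdot b u y) + (shdot a v x + shdot b v y).
Proof. by rewrite !shdot_linear_l scalerDr addrACA. Qed.

Lemma wsucc_lin_l c x x1 x2 : wlin c x x1 x2 ->
  (forall a y, wprec a x y = c *: wprec a x1 y + wprec a x2 y) ->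
  forall a y, wsucc a x y = c *: wsucc a x1 y + wsucc a x2 y.
Proof.
move=> xl px a [t z]; elim: t a => [|[b w] t IHt] a.
  by rewrite !wsucc_letter (wlin_shword xl) shdot_is_linear.
by rewrite !(wsucc_dot a b w _ (t, z)) -shdotD2 px IHt.
Qed.

Lemma wprod_lin_l c x x1 x2 : wlin c x x1 x2 ->
  (forall a y, wprec a x y = c *: wprec a x1 y + wprec a x2 y) /\
  (forall a y, wsucc a x y = c *: wsucc a x1 y + wsucc a x2 y).
Proof.
move=> xl; suff px a y : wprec a x y = c *: wprec a x1 y + wprec a x2 y.
  by split=> //; apply: wsucc_lin_l.
elim: xl a y => {x x1 x2} [u v|b s z u v|[b v] s z s1 z1 s2 z2 xl IHx] a y.
- by rewrite !wprec_letter shdot_linear_l.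
- by rewrite !(wprec_dot a b _ (s, z)) -shdotD2l.
- rewrite (wprec_dot a b v (s, z)) (wprec_dot a b v (s1, z1)).
  rewrite (wprec_dot a b v (s2, z2)) -shdotD2 IHx.
  by rewrite (wsucc_lin_l xl IHx).
Qed.

Lemma wprec_lin_r c y y1 y2 : wlin c y y1 y2 ->
  (forall a x, wsucc a x y = c *: wsucc a x y1 + wsucc a x y2) ->
  forall a x, wprec a x y = c *: wprec a x y1 + wprec a x y2.
Proof.
move=> yl py a [s u]; elim: s a => [|[b v] s IHs] a.
  by rewrite !wprec_letter (wlin_shword yl) shdot_is_linear.
by rewrite !(wprec_dot a b v (s, u)) -shdotD2 py IHs.
Qed.

Lemma wprod_lin_r c y y1 y2 : wlin c y y1 y2 ->
  (forall a x, wprec a x y = c *: wprec a x y1 + wprec a x y2) /\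
  (forall a x, wsucc a x y = c *: wsucc a x y1 + wsucc a x y2).
Proof.
move=> yl; suff py a x : wsucc a x y = c *: wsucc a x y1 + wsucc a x y2.
  by split=> //; apply: wprec_lin_r.
elim: yl a x => {y y1 y2} [u v|b s z u v|[b v] s z s1 z1 s2 z2 yl IHy] a x.
- by rewrite !wsucc_letter shdot_linear_l.
- by rewrite !(wsucc_dot a b _ _ (s, z)) -shdotD2l.
- rewrite (wsucc_dot a b v _ (s, z)) (wsucc_dot a b v _ (s1, z1)).
  rewrite (wsucc_dot a b v _ (s2, z2)) -shdotD2 IHy.
  by rewrite (wprec_lin_r yl IHy).
Qed.

(* The bilinear extensions of wprec a and wsucc a. They are determined by the
   recursion shprec_letter, shsucc_letter, shprec_dot and shsucc_dot below. *)
Definition shprec (a : Omega) (x y : Sh) : Sh :=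
  shlift (fun w1 => shlift (wprec a w1) y) x.
Definition shsucc (a : Omega) (x y : Sh) : Sh :=
  shlift (fun w1 => shlift (wsucc a w1) y) x.

Lemma wprec_multilinear a w : multilinear (wprec a w).
Proof. by apply/multilinearP => c x x1 x2 /wprod_lin_r[->]. Qed.

Lemma wsucc_multilinear a w : multilinear (wsucc a w).
Proof. by apply/multilinearP => c x x1 x2 /wprod_lin_r[_ ->]. Qed.

Lemma shlift_wprec_multilinear a y :
  multilinear (fun w => shlift (wprec a w) y).
Proof.
by apply/multilinearP => c x x1 x2 /wprod_lin_l[xl _]; apply: linext_lin.
Qed.

Lemma shlift_wsucc_multilinear a y :
  multilinear (fun w => shlift (wsucc a w) y).
Proof.
by apply/multilinearP => c x x1 x2 /wprod_lin_l[_ xl]; apply: linext_lin.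
Qed.

Lemma shprec_word a x y : shprec a (shword x) (shword y) = wprec a x y.
Proof.
rewrite /shprec shlift_word; last exact: shlift_wprec_multilinear.
by rewrite shlift_word //; apply: wprec_multilinear.
Qed.

Lemma shsucc_word a x y : shsucc a (shword x) (shword y) = wsucc a x y.
Proof.
rewrite /shsucc shlift_word; last exact: shlift_wsucc_multilinear.
by rewrite shlift_word //; apply: wsucc_multilinear.
Qed.

Lemma shprec_linear_l a y : linear (shprec a ^~ y).
Proof. exact/shlift_is_linear/shlift_wprec_multilinear. Qed.

Lemma shsucc_linear_l a y : linear (shsucc a ^~ y).
Proof. exact/shlift_is_linear/shlift_wsucc_multilinear. Qed.

Lemma shprec_linear_r a x : linear (shprec a x).
Proof.
move=> c y z; apply: linext_lin => w.
exact/shlift_is_linear/wprec_multilinear.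
Qed.

Lemma shsucc_linear_r a x : linear (shsucc a x).
Proof.
move=> c y z; apply: linext_lin => w.
exact/shlift_is_linear/wsucc_multilinear.
Qed.

Lemma linear_eq (f g : Sh -> Sh) : linear f -> linear g ->
  (forall w, f (shword w) = g (shword w)) -> f =1 g.
Proof.
move=> fl gl fg; have f0 (h : Sh -> Sh) : linear h -> h 0 = 0.
  by move=> hl; have := hl (-1) 0 0; rewrite scaler0 addr0 scaleN1r addNr.
by apply: sh_ind => [|c x y IHx IHy|//]; rewrite ?f0 // fl gl IHx IHy.
Qed.

Lemma shprec_letter a v y : shprec a (shletter Omega v) y = shdot a v y.
Proof.
move: y; apply: linear_eq; [exact: shprec_linear_r | exact: shdot_is_linear|].
by move=> w; rewrite shprec_word wprec_letter.
Qed.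

Lemma shsucc_letter a x w : shsucc a x (shletter Omega w) = shdot a w x.
Proof.
move: x; apply: linear_eq; [exact: shsucc_linear_l | exact: shdot_is_linear|].
by move=> x; rewrite shsucc_word wsucc_letter.
Qed.

Lemma shprec_dot a b v x y : shprec a (shdot b v x) y =
  shdot (b ← a) v (shprec (b ◁ a) x y) + shdot (b → a) v (shsucc (b ▷ a) x y).
Proof.
move: y; apply: linear_eq => [||w]; first exact: shprec_linear_r.
  by move=> c y z; rewrite shprec_linear_r shsucc_linear_r -shdotD2.
move: x; apply: linear_eq => [c x y|c x y|x].
- by rewrite shdot_is_linear shprec_linear_l.
- by rewrite shprec_linear_l shsucc_linear_l -shdotD2.
by rewrite shdot_word !shprec_word shsucc_word wprec_dot.
Qed.

Lemma shsucc_dot a b w x y : shsucc a x (shdot b w y) =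
  shdot (a ← b) w (shprec (a ◁ b) x y) + shdot (a → b) w (shsucc (a ▷ b) x y).
Proof.
move: x; apply: linear_eq => [||x]; first exact: shsucc_linear_l.
  by move=> c y' z; rewrite shprec_linear_l shsucc_linear_l -shdotD2.
move: y; apply: linear_eq => [c y z|c y z|y].
- by rewrite shdot_is_linear shsucc_linear_r.
- by rewrite shprec_linear_r shsucc_linear_r -shdotD2.
by rewrite shdot_word !shsucc_word shprec_word wsucc_dot.
Qed.

End Products.

(* tword [tuple α_2; …; α_n] [tuple v_1; …; v_n] is α_2…α_n ⊗ v_1…v_n: the
   sequence [zip a v] drops the last letter. *)
Definition tword (K : fieldType) (Omega : choiceType) (V : lmodType K) (n : nat)
    (a : n.-tuple Omega) (v : n.+1.-tuple V) : ShPlus Omega V :=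
  shword (zip a v, tnth v ord_max).

Lemma tword_letter (K : fieldType) (Omega : choiceType) (V : lmodType K)
  (v : V) : tword [tuple] [tuple v] = shletter Omega v.
Proof. by rewrite /tword (tnth_nth v). Qed.

Lemma tword_cons (K : fieldType) (Omega : choiceType) (V : lmodType K) (n : nat)
    (b : Omega) (v : V) (a : n.-tuple Omega) (u : n.+1.-tuple V) :
  tword [tuple of b :: a] [tuple of v :: u] = shdot b v (tword a u).
Proof. by rewrite shdot_word /tword /wdot /= !(tnth_nth v). Qed.

Section Shuffles.
Variables k l : nat.

Definition sh : {set 'S_(k + l)} :=
  [set s : 'S_(k + l) |
     [forall i : 'I_k, forall j : 'I_k,
        (i < j)%N ==> (s (lshift l i) < s (lshift l j))%N]
  && [forall i : 'I_l, forall j : 'I_l,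
        (i < j)%N ==> (s (rshift k i) < s (rshift k j))%N]].

End Shuffles.

(* For k, l >= 1, written k.+1, l.+1; positions and values are shifted by one:
   1 is ord0 and k.+2, the first position of the second block, is
   rshift k.+1 ord0. *)
Definition sh_prec (k l : nat) : {set 'S_(k.+1 + l.+1)} :=
  [set s in sh k.+1 l.+1 | (s^-1)%g ord0 == lshift l.+1 (@ord0 k)].
Definition sh_succ (k l : nat) : {set 'S_(k.+1 + l.+1)} :=
  [set s in sh k.+1 l.+1 | (s^-1)%g ord0 == rshift k.+1 (@ord0 l)].

Definition perm_word (n : nat) (s : 'S_n) : seq nat :=
  [seq (s i).+1 | i <- enum 'I_n].

Section D.
Variable Omega : edsType.
Local Open Scope eds_scope.

(* Dword a c b w is D_w (a, c, b), with a = (α_2, …, α_k), c = α_(k+1) and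
   b = (α_(k+2), …, α_(k+l)), for a (k,l)-shuffle given by its word
   w = (w(1), …, w(k+l)); [index 1 w == 0] means w^-1(1) = 1, and otherwise
   w^-1(1) = k+1 = (size a).+2. *)
Fixpoint Dword (a : seq Omega) : Omega -> seq Omega -> seq nat -> seq Omega :=
  fix Dword_a (c : Omega) (b : seq Omega) (w : seq nat) {struct b} :=
  if index 1%N w == 0%N then
    if a is a2 :: a' then
      let w' := [seq i.-1 | i <- behead w] in
      if index 1%N w' == 0%N then (a2 ← c) :: Dword a' (a2 ◁ c) b w'
      else (a2 → c) :: Dword a' (a2 ▷ c) b w'
    else c :: b
  else
    if b is b1 :: b' then
      let w' := [seq i.-1 | i <- take (size a).+1 w ++ drop (size a).+2 w] in
      if index 1%N w' == 0%N then (c ← b1) :: Dword_a (c ◁ b1) b' w'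
      else (c → b1) :: Dword_a (c ▷ b1) b' w'
    else c :: a.

Lemma size_Dword a c b w : size (Dword a c b w) = (size a + (size b).+1)%N.
Proof.
elim: a c b w => [|a2 a IHa] c b; elim: b c => [|b1 b IHb] c w /=;
  by do !case: ifP => _ //=; rewrite ?IHa ?IHb ?addn1 ?addnS.
Qed.

Lemma Dmap_subproof (k l : nat) (s : 'S_(k.+1 + l.+1))
    (a : (k + l.+1).-tuple Omega) :
  size (Dword (take k a) (tnth a (rshift k ord0)) (drop k.+1 a) (perm_word s))
    == (k + l.+1)%N.
Proof.
rewrite size_Dword size_drop size_takel size_tuple ?leq_addr //.
by rewrite !addnS subSS addKn.
Qed.

(* The map D^(k+1,l+1)_s. *)
Definition Dmap (k l : nat) (s : 'S_(k.+1 + l.+1)) (a : (k + l.+1).-tuple Omega) :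
  (k + l.+1).-tuple Omega := Tuple (Dmap_subproof s a).

End D.

(* Main.v *)
(* Restricting to sigma^-1(1) = 1 or sigma^-1(1) = k + 1 and deleting the value
   1 identifies the (k,l)-shuffles with the disjoint union of the (k-1,l)- and
   the (k,l-1)-shuffles. Along this decomposition the recursion defining
   D_sigma is exactly the one defining the two products, so both formulas
   follow together by induction on k + l. *)
Require Import Defs.
From mathcomp Require Import all_boot all_fingroup all_algebra.
From mathcomp Require Import zify.

Set Implicit Arguments.
Unset Strict Implicit.
Unset Printing Implicit Defensive.

Import GRing.Theory.
Local Open Scope ring_scope.

(** * Recursive enumeration of the encoded shuffles *)

(* A (k,l)-shuffle s is encoded by the pair of its two increasing blocks
   (s(1), …, s(k)) and (s(k+1), …, s(k+l)). *)
Definition prec_cons (r : seq nat * seq nat) : seq nat * seq nat :=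
  (1%N :: map succn r.1, map succn r.2).
(** [prec_cons] and [succ_cons] undo the deletion of the value 1 from the first and the second block
    respectively: they lead from sigma' back to sigma. *)
Definition succ_cons (r : seq nat * seq nat) : seq nat * seq nat :=
  (map succn r.1, 1%N :: map succn r.2).

(** The nested fixpoint has the shape of [wprod]: each call shortens one block. Once a block is
    empty, only the identity is left. *)
Fixpoint shufs (k : nat) : nat -> seq (seq nat * seq nat) :=
  fix shufs_k l :=
  if k is k'.+1 then
    if l is l'.+1 then map prec_cons (shufs k' l) ++ map succ_cons (shufs_k l')
    else [:: (iota 1 k, [::])]
  else [:: ([::], iota 1 l)].

Lemma shufsSS k l : shufs k.+1 l.+1 =
  map prec_cons (shufs k l.+1) ++ map succ_cons (shufs k.+1 l).
Proof. by []. Qed.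

Definition is_shuf (k l : nat) (r : seq nat * seq nat) : bool :=
  [&& size r.1 == k, sorted ltn r.1, sorted ltn r.2
    & perm_eq (r.1 ++ r.2) (iota 1 (k + l))].

Lemma sorted_map_succn s : sorted ltn (map succn s) = sorted ltn s.
Proof. by rewrite sorted_map. Qed.

Lemma perm_iota_succn n s :
  perm_eq (map succn s) (iota 2 n) = perm_eq s (iota 1 n).
Proof.
rewrite (iotaDl 1 1 n); apply/idP/idP => [/(perm_map predn)|].
  by rewrite -!map_comp map_id (eq_map (g := id)) ?map_id.
exact: perm_map.
Qed.

Lemma sorted_cons1 s : all (leq 1) s ->
  sorted ltn (1%N :: map succn s) = sorted ltn s.
Proof.
move=> s1; rewrite /= path_sortedE; last exact: ltn_trans.
by rewrite sorted_map_succn all_map (eq_all (a2 := leq 1)) ?s1.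
Qed.

Lemma perm_iota1_all n s : perm_eq s (iota 1 n) -> all (leq 1) s.
Proof.
by move=> /perm_all->; apply/allP => i; rewrite mem_iota => /andP[].
Qed.

(** If the entries form 1, ..., k+l, they are positive, so after the shift a 1 in front keeps the
    block increasing; otherwise both sides are false. *)
Lemma is_shuf_prec k l r : is_shuf k.+1 l (prec_cons r) = is_shuf k l r.
Proof.
case: r => p q; rewrite /is_shuf; cbn [fst snd prec_cons].
rewrite [size _]/= eqSS size_map sorted_map_succn addSn.
rewrite [iota 1 _]/= cat_cons perm_cons -map_cat perm_iota_succn.
case pq: (perm_eq _ _); last by rewrite !andbF.
rewrite sorted_cons1 //; move: (perm_iota1_all pq).
by rewrite all_cat => /andP[].
Qed.

Lemma is_shuf_succ k l r : is_shuf k l.+1 (succ_cons r) = is_shuf k l r.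
Proof.
case: r => p q; rewrite /is_shuf; cbn [fst snd succ_cons].
rewrite size_map sorted_map_succn addnS -cat1s perm_catCA cat1s.
rewrite [iota 1 _]/= perm_cons -map_cat perm_iota_succn.
case pq: (perm_eq _ _); last by rewrite !andbF.
rewrite sorted_cons1 //; move: (perm_iota1_all pq).
by rewrite all_cat => /andP[].
Qed.

Lemma map_predK s : all (leq 1) s -> map succn (map predn s) = s.
Proof.
by move=> /allP s1; rewrite -map_comp map_id_in // => -[|i] /s1.
Qed.

Lemma sorted_head1 s : all (leq 1) s -> sorted ltn s -> 1%N \in s ->
  s = 1%N :: map succn (map predn (behead s)).
Proof.
case: s => [//|x s] /= /andP[x1 s1] xs; rewrite inE map_predK // => ins.
congr (_ :: _); case/predU1P: ins => // ins.
move: xs; rewrite path_sortedE; last exact: ltn_trans.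
by move=> /andP[/allP/(_ _ ins)]; lia.
Qed.

(** The value 1 occurs in one of the blocks and, being minimal, heads it. The witness removes it
    there and decrements all other entries. *)
Lemma is_shufP k l r : is_shuf k l.+1 r ->
  exists r', r = prec_cons r' \/ r = succ_cons r'.
Proof.
case: r => p q /and4P[/= _ sp sq pq].
exists (map predn (if 1%N \in p then behead p else p),
        map predn (if 1%N \in p then q else behead q)).
have := perm_iota1_all pq; rewrite all_cat => /andP[p1 q1].
have := perm_mem pq 1%N; rewrite mem_cat mem_iota addnS ltnS /=.
case: ifP => [inp _|_ /= inq]; [left|right].
  by rewrite /prec_cons /= -(sorted_head1 p1) // map_predK.
by rewrite /succ_cons /= -(sorted_head1 q1) // map_predK.
Qed.

Lemma prec_cons_inj : injective prec_cons.
Proof.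
by move=> [p q] [p' q'] [] /(inj_map succn_inj) -> /(inj_map succn_inj) ->.
Qed.

Lemma succ_cons_inj : injective succ_cons.
Proof.
by move=> [p q] [p' q'] [] /(inj_map succn_inj) -> /(inj_map succn_inj) ->.
Qed.

Lemma is_shuf_head0 k l p q : is_shuf k l (p, q) -> 0%N \notin p ++ q.
Proof. by case/and4P => _ _ _ /perm_mem ->; rewrite mem_iota. Qed.

Lemma perm_iota_sorted n s :
  sorted ltn s && perm_eq s (iota 1 n) = (s == iota 1 n).
Proof.
apply/andP/eqP => [[ss sn]|->]; last by rewrite iota_ltn_sorted.
apply: (irr_sorted_eq ltn_trans ltnn ss (iota_ltn_sorted 1 n)).
exact: perm_mem.
Qed.

Lemma mem_shufs k l r : (r \in shufs k l) = is_shuf k l r.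
Proof.
elim: k l r => [|k IHk] l; last elim: l => [|l IHl] r.
- move=> [p q]; rewrite [shufs _ _](_ : _ = [:: ([::], iota 1 l)]); last by case: l.
  rewrite inE xpair_eqE /is_shuf /= size_eq0; case: eqP => [->|] //=.
  by rewrite perm_iota_sorted.
- case: r => p q; rewrite inE xpair_eqE /is_shuf /= addn0; apply/idP/idP.
    move=> /andP[/eqP-> /eqP->]; rewrite /= size_iota eqxx cats0 perm_refl.
    by rewrite !andbT; apply: (iota_ltn_sorted 1 k.+1).
  (* Comparing lengths forces the second block to be empty. *)
  case/and4P=> /eqP sp ss _ pq; have := perm_size pq.
  rewrite size_cat sp /= size_iota => /eqP; rewrite -[X in _ == X]addn0 eqn_add2l.
  rewrite size_eq0 => /eqP q0; move: pq; rewrite q0 cats0 => pq.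
  have := perm_iota_sorted k.+1 p; rewrite ss /= pq => /esym/eqP->.
  by rewrite !eqxx.
rewrite mem_cat; apply/orP/idP => [[]/mapP[r' r'in ->]|rs].
- by rewrite is_shuf_prec -IHk.
- by rewrite is_shuf_succ -IHl.
case: (is_shufP rs) => r' [] rE; move: rs; rewrite rE.
  by rewrite is_shuf_prec -IHk => r'in; left; apply: map_f.
by rewrite is_shuf_succ -IHl => r'in; right; apply: map_f.
Qed.

Lemma shufs_uniq k l : uniq (shufs k l).
Proof.
elim: k l => [|k IHk] l; first by case: l.
elim: l => [//|l IHl]; rewrite shufsSS cat_uniq (map_inj_uniq prec_cons_inj).
rewrite (map_inj_uniq succ_cons_inj) IHk IHl andbT andTb.
apply/hasPn => _ /mapP[[p q] pq ->].
(* A common element would have 1 at the head of a shifted first block, hence 0 in a block of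
   positive entries. *)
apply/negP => /mapP[[p' q'] _ []].
case: p pq => // i p; rewrite mem_shufs => /is_shuf_head0.
by rewrite inE negb_or => /andP[/eqP + _] [i0]; rewrite i0.
Qed.

(** * Products of typed words as sums over encoded shuffles *)

(** Counterpart of [tword] on sequences, meant for [v] one longer than [a]; the default 0 is reached
    only for empty [v]. *)
Definition lword (V : nmodType) (Omega : Type) (a : seq Omega) (v : seq V) :
  word Omega V := (zip a v, last 0 v).

Section WordProducts.
Variables (K : fieldType) (V : lmodType K) (Omega : edsType).
Implicit Types (a b : seq Omega) (c : Omega) (u t v : seq V).
Implicit Types r : seq nat * seq nat.

(* v_(w^-1(1)) … v_(w^-1(n)) for the word w = (w(1), …, w(n)). *)
Definition letters v (w : seq nat) : seq V :=
  [seq v`_(index i w) | i <- iota 1 (size w)].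

Lemma letters_iota v : letters v (iota 1 (size v)) = v.
Proof.
apply: (@eq_from_nth _ 0) => [|i]; rewrite size_map !size_iota // => iv.
rewrite (nth_map 0%N) ?size_iota // nth_iota // -{1}(nth_iota 0%N 1 iv).
by rewrite index_uniq ?size_iota ?iota_uniq.
Qed.

Lemma index_succn i (s : seq nat) : index i.+1 (map succn s) = index i s.
Proof. exact: (index_map succn_inj). Qed.

Lemma letters_prec v x r :
  letters (x :: v) ((prec_cons r).1 ++ (prec_cons r).2) =
  x :: letters v (r.1 ++ r.2).
Proof.
rewrite /letters /= -map_cat size_map (iotaDl 1 1) -map_comp.
congr (_ :: _); apply/eq_in_map => i; rewrite mem_iota => /andP[i1 _] /=.
by case: i i1 => // i _; rewrite index_succn.
Qed.

(** As 1 is absent from the shifted first block, its index is the length of that block, which is the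
    position of [x]. Removing [x] compensates the unit shift of the later indices. *)
Lemma letters_succ u t x r : size r.1 = size u -> 0%N \notin r.1 ->
  letters (u ++ x :: t) ((succ_cons r).1 ++ (succ_cons r).2) =
  x :: letters (u ++ t) (r.1 ++ r.2).
Proof.
case: r => p q /= sp p0; rewrite /letters !size_cat /= !size_map addnS /=.
rewrite (iotaDl 1 1) -map_comp; congr (_ :: _).
  by rewrite index_cat (mem_map succn_inj) (negPf p0) /= size_map sp addn0
             nth_cat ltnn subnn.
apply/eq_in_map => i; rewrite mem_iota => /andP[i1 _] /=.
rewrite add1n !index_cat (mem_map succn_inj) size_map index_succn /=.
rewrite eqSS eq_sym (negPf (lt0n_neq0 i1)) index_succn sp !nth_cat.
have [pi|_] := boolP (i \in p); first by rewrite -sp index_mem pi.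
by rewrite !ltnNge !leq_addr /= !addKn.
Qed.

Lemma index1_succ r : 0%N \notin r.1 ->
  index 1%N ((succ_cons r).1 ++ (succ_cons r).2) = size r.1.
Proof.
move=> p0; rewrite index_cat (mem_map succn_inj) (negPf p0) /=.
by rewrite size_map addn0.
Qed.

Lemma Dword_nil_prec c b r :
  Dword [::] c b ((prec_cons r).1 ++ (prec_cons r).2) = c :: b.
Proof. by case: b. Qed.

(** Clause (ii) of the recursion for D: dropping the leading 1 and decrementing returns the word of
    [r], whose index of 1 selects the branch. *)
Lemma Dword_cons_prec (z : Omega) a c b r (w := r.1 ++ r.2) :
  Dword (z :: a) c b ((prec_cons r).1 ++ (prec_cons r).2) =
  if index 1%N w == 0%N then dleft z c :: Dword a (tleft z c) b w
  else dright z c :: Dword a (tright z c) b w.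
Proof.
have -> : w = [seq i.-1 | i <- behead ((prec_cons r).1 ++ (prec_cons r).2)].
  by rewrite /= -map_cat -map_comp map_id.
by case: b.
Qed.

Lemma Dword_succ_nil a c r : size r.1 = (size a).+1 -> 0%N \notin r.1 ->
  Dword a c [::] ((succ_cons r).1 ++ (succ_cons r).2) = c :: a.
Proof. by case: a => [|z a] sr r0 /=; rewrite index1_succ // sr. Qed.

(** Clause (iv) of the recursion for D: 1 stands right after the first block, at index
    [(size a).+1], so cutting it out there and decrementing returns the word of [r]. *)
Lemma Dword_succ_cons a c (y : Omega) b r (w := r.1 ++ r.2) :
  size r.1 = (size a).+1 -> 0%N \notin r.1 ->
  Dword a c (y :: b) ((succ_cons r).1 ++ (succ_cons r).2) =
  if index 1%N w == 0%N then dleft c y :: Dword a (tleft c y) b w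
  else dright c y :: Dword a (tright c y) b w.
Proof.
move=> sr r0; set w' := (succ_cons r).1 ++ (succ_cons r).2.
have wE : w = [seq i.-1 | i <- take (size a).+1 w' ++ drop (size a).+2 w'].
  have sp : size (map succn r.1) = (size a).+1 by rewrite size_map.
  rewrite take_cat drop_cat sp ltnn ltnNge leqnSn subnn take0 cats0 subSnn.
  by rewrite /= drop0 -map_cat -map_comp map_id.
(* The first block is nonempty, so 1 is not the first value and the second case of [Dword]
   applies. *)
have : index 1%N w' != 0%N by rewrite index1_succ // sr.
by rewrite wE; case: a {sr wE} => [|z a] /= /negPf->.
Qed.

Definition shuf_term a c b v (r : seq nat * seq nat) : ShPlus Omega V :=
  shword (lword (Dword a c b (r.1 ++ r.2)) (letters v (r.1 ++ r.2))).

Lemma lword_cons a x v z : size v = (size a).+1 ->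
  lword (z :: a) (x :: v) = wdot z x (lword a v).
Proof. by case: v. Qed.

Lemma size_letters v w : size (letters v w) = size w.
Proof. by rewrite size_map size_iota. Qed.

Lemma is_shuf_blocks k l r : is_shuf k l r ->
  [/\ size r.1 = k, 0%N \notin r.1 & size (r.1 ++ r.2) = (k + l)%N].
Proof.
case: r => p q rs; have := is_shuf_head0 rs.
case/and4P: rs => /= /eqP-> _ _ /perm_size->; rewrite size_iota mem_cat.
by case/norP.
Qed.

Lemma shuf_term_prec (z : Omega) x a c b v r :
  size (r.1 ++ r.2) = (size a + (size b).+1).+1 ->
  shuf_term (z :: a) c b (x :: v) (prec_cons r) =
  if index 1%N (r.1 ++ r.2) == 0%N
  then shdot (dleft z c) x (shuf_term a (tleft z c) b v r)
  else shdot (dright z c) x (shuf_term a (tright z c) b v r).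
Proof.
move=> sr; rewrite /shuf_term letters_prec Dword_cons_prec.
by case: ifP => _; rewrite lword_cons ?shdot_word // size_letters size_Dword.
Qed.

Lemma shuf_term_succ (y : Omega) x a c b u t r :
  size u = (size a).+1 -> size r.1 = (size a).+1 -> 0%N \notin r.1 ->
  size (r.1 ++ r.2) = (size a + (size b).+1).+1 ->
  shuf_term a c (y :: b) (u ++ x :: t) (succ_cons r) =
  if index 1%N (r.1 ++ r.2) == 0%N
  then shdot (dleft c y) x (shuf_term a (tleft c y) b (u ++ t) r)
  else shdot (dright c y) x (shuf_term a (tright c y) b (u ++ t) r).
Proof.
move=> su sr r0 srr; rewrite /shuf_term letters_succ ?sr ?su //.
rewrite Dword_succ_cons //.
by case: ifP => _; rewrite lword_cons ?shdot_word // size_letters size_Dword.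
Qed.

(** The index of 1 is 0 on the first half of the enumeration and k+1 on the second. This joins the
    two sums produced by one step of a product into a single sum. *)
Lemma big_shufs_if (M : zmodType) k l (F G : seq nat * seq nat -> M) :
  \sum_(r <- shufs k.+1 l.+1)
     (if index 1%N (r.1 ++ r.2) == 0%N then F r else G r) =
  \sum_(r <- map prec_cons (shufs k l.+1)) F r +
  \sum_(r <- map succ_cons (shufs k.+1 l)) G r.
Proof.
rewrite shufsSS big_cat !big_map; congr (_ + _).
apply: eq_big_seq => r; rewrite mem_shufs => /is_shuf_blocks[sr r0 _].
by rewrite index1_succ // sr.
Qed.

(** Strong induction on the total length: the recursion for either product calls both products,
    after removing the first letter of [x] for the left one and of [y] for the right one. *)
Lemma wprod_shufs a c b u t : size u = (size a).+1 -> size t = (size b).+1 ->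
  wprec c (lword a u) (lword b t) =
    \sum_(r <- map prec_cons (shufs (size a) (size b).+1))
      shuf_term a c b (u ++ t) r /\
  wsucc c (lword a u) (lword b t) =
    \sum_(r <- map succ_cons (shufs (size a).+1 (size b)))
      shuf_term a c b (u ++ t) r.
Proof.
have [n] := ubnP (size a + size b); elim: n => // n IHn in a b c u t *.
rewrite ltnS => sab su st; split.
- case: a u su sab => [|z a] [|x u] // su sab.
    (* A single letter on the left: the identity is the only shuffle. *)
    case: u su => // _; rewrite big_seq1 /shuf_term letters_prec.
    rewrite Dword_nil_prec wprec_letter shdot_word -lword_cons //.
    by congr (shword (lword _ (_ :: _))); rewrite -[LHS]letters_iota st.
  case: su => su; have {}sab : (size a + size b < n)%N by [].
  rewrite lword_cons // wprec_dot.
  have [-> _] := IHn a b (tleft z c) u t sab su st.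
  have [_ ->] := IHn a b (tright z c) u t sab su st.
  (* Both inner sums become one sum over all shuffles sigma', where the case distinction is the one
     in D. *)
  rewrite !linear_sum -big_shufs_if [RHS]big_map.
  apply: eq_big_seq => r; rewrite mem_shufs => /is_shuf_blocks[_ _ sr].
  by rewrite shuf_term_prec // sr addSn.
- case: b t st sab => [|y b] [|x t] // st sab.
    (* A single letter on the right: the only shuffle moves it to the front. *)
    case: t st => // _; rewrite big_seq1 /shuf_term letters_succ ?size_iota //.
      rewrite Dword_succ_nil ?size_iota ?mem_iota // cats0.
      rewrite wsucc_letter shdot_word cats0 -su letters_iota.
      by rewrite -lword_cons.
    by rewrite mem_iota.
  case: st => st; have {}sab : (size a + size b < n)%N by rewrite -addnS.
  rewrite [lword (y :: b) _]lword_cons // wsucc_dot.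
  have [-> _] := IHn a b (tleft c y) u t sab su st.
  have [_ ->] := IHn a b (tright c y) u t sab su st.
  rewrite !linear_sum -big_shufs_if [RHS]big_map.
  apply: eq_big_seq => r; rewrite mem_shufs => /is_shuf_blocks[sr r0 srr].
  by rewrite shuf_term_succ // srr addSn.
Qed.

End WordProducts.

(** * Permutations and their encodings *)

(** Values of the word start at 1, positions at 0. This turns the test on [index 1] in [Dword] into
    the condition on sigma^-1(1). *)
Lemma perm_word_index n (s : 'S_n) (i : 'I_n) :
  index i.+1 (perm_word s) = (s^-1)%g i.
Proof.
have sinj : injective (fun j => (s j).+1) by move=> x y [] /val_inj/perm_inj.
rewrite /perm_word -[in LHS](permKV s i) (index_map sinj).
by rewrite index_enum_ord.
Qed.

Lemma perm_word_perm_iota n (s : 'S_n) : perm_eq (perm_word s) (iota 1 n).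
Proof.
have sinj : injective (fun j => (s j).+1) by move=> x y [] /val_inj/perm_inj.
have us : uniq (perm_word s) by rewrite map_inj_uniq ?enum_uniq.
apply: uniq_perm; rewrite ?iota_uniq // => i.
rewrite mem_iota add1n; apply/mapP/andP => [[j _ ->]|[i0 iN]].
  by split; rewrite // ltnS ltn_ord.
have iN' : (i.-1 < n)%N by lia.
exists ((s^-1)%g (Ordinal iN')); rewrite ?mem_enum // permKV /=; lia.
Qed.

Lemma perm_word_inj n : injective (@perm_word n).
Proof.
move=> s s' ss'; apply: invg_inj; apply/permP => i; apply: val_inj => /=.
by rewrite -!perm_word_index ss'.
Qed.

Lemma perm_word_onto n w : perm_eq w (iota 1 n) ->
  exists s : 'S_n, perm_word s = w.
Proof.
move=> wn; have sw := perm_size wn; rewrite size_iota in sw.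
have uw : uniq w by rewrite (perm_uniq wn) iota_uniq.
have wP i : (i < n)%N -> (0 < nth 0 w i < n.+1)%N.
  by move=> i_n; rewrite -[n.+1]add1n -mem_iota -(perm_mem wn) mem_nth ?sw.
(* The word takes values 1, ..., n and a permutation of ['I_n] takes 0, ..., n-1, hence the
   predecessor. *)
have fP (i : 'I_n) : ((nth 0 w i).-1 < n)%N by have := wP i (ltn_ord i); lia.
have finj : injective (fun i => Ordinal (fP i)).
  move=> i j [] ij; apply/val_inj/eqP; rewrite -(nth_uniq 0%N _ _ uw) ?sw
    ?ltn_ord //=.
  by have := wP i (ltn_ord i); have := wP j (ltn_ord j); lia.
exists (perm finj); apply: (@eq_from_nth _ 0%N) => [|i].
  by rewrite size_map size_enum_ord.
rewrite size_map size_enum_ord => i_n.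
rewrite (nth_map (Ordinal i_n)) ?size_enum_ord // permE /= nth_enum_ord //.
by have := wP i i_n; lia.
Qed.

Definition perm_pair k l (s : 'S_(k + l)) : seq nat * seq nat :=
  (take k (perm_word s), drop k (perm_word s)).

Lemma perm_pair_cat k l (s : 'S_(k + l)) :
  (perm_pair s).1 ++ (perm_pair s).2 = perm_word s.
Proof. exact: cat_take_drop. Qed.

(** [sorted] compares neighbours only; transitivity extends this to all pairs, as in the definition
    of [sh]. *)
Lemma sorted_map_ord n (f : 'I_n -> nat) :
  sorted ltn [seq f i | i <- enum 'I_n] =
  [forall i : 'I_n, forall j : 'I_n, (i < j)%N ==> (f i < f j)%N].
Proof.
have srt : sorted (fun i j : 'I_n => (i < j)%N) (enum 'I_n).
  have := iota_ltn_sorted 0 n; rewrite -val_enum_ord sorted_map.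
  exact.
rewrite sorted_map; apply/idP/'forall_'forall_implyP => [fs i j ij|fP].
  have tr : transitive (relpre f ltn) by move=> x y z; apply: ltn_trans.
  have := sorted_ltn_nth tr i fs; move=> /(_ i j).
  rewrite !inE !size_enum_ord !ltn_ord /= !nth_ord_enum.
  exact.
by apply: sub_sorted srt => i j; apply: fP.
Qed.

Lemma enum_lrshift k l :
  enum 'I_(k + l) =
  map (@lshift k l) (enum 'I_k) ++ map (@rshift k l) (enum 'I_l).
Proof.
apply: (inj_map val_inj); rewrite val_enum_ord map_cat iotaD; congr (_ ++ _).
  by rewrite -map_comp -[LHS]val_enum_ord.
rewrite add0n -[X in iota X]addn0 iotaDl -val_enum_ord.
by rewrite -!(map_comp _ _ (enum _)).
Qed.

Lemma perm_pairE k l (s : 'S_(k + l)) : perm_pair s =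
  ([seq (s (lshift l i)).+1 | i <- enum 'I_k],
   [seq (s (rshift k i)).+1 | i <- enum 'I_l]).
Proof.
rewrite /perm_pair /perm_word enum_lrshift map_cat.
rewrite -(map_comp _ (@lshift k l)) -(map_comp _ (@rshift k l)).
by rewrite take_size_cat ?drop_size_cat // size_map size_enum_ord.
Qed.

Lemma mem_sh k l (s : 'S_(k + l)) : (s \in sh k l) = is_shuf k l (perm_pair s).
Proof.
rewrite /is_shuf perm_pair_cat perm_word_perm_iota andbT perm_pairE /=.
by rewrite size_map size_enum_ord eqxx !sorted_map_ord inE.
Qed.

Lemma perm_pair_inj k l : injective (@perm_pair k l).
Proof.
by move=> s s' ss'; apply: perm_word_inj; rewrite -!perm_pair_cat ss'.
Qed.

Lemma is_shuf_onto k l r : is_shuf k l r ->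
  exists2 s, s \in sh k l & r = perm_pair s.
Proof.
move=> rs; have [sr _ _] := is_shuf_blocks rs.
case/and4P: (rs) => _ _ _ /perm_word_onto[s sE].
have rE : r = perm_pair s.
  by rewrite /perm_pair sE -sr take_size_cat // drop_size_cat //; case: (r).
by exists s; rewrite // mem_sh -rE.
Qed.

(** Reindexing along the injective map [perm_pair]; the inclusion in [shufs k l] makes every pair in
    [rs] the image of a permutation. *)
Lemma sum_perm_pair (M : zmodType) k l (A : {set 'S_(k + l)}) rs
    (F : seq nat * seq nat -> M) :
  uniq rs -> (forall s, s \in A = (perm_pair s \in rs) :> bool) ->
  {subset rs <= shufs k l} ->
  \sum_(s in A) F (perm_pair s) = \sum_(r <- rs) F r.
Proof.
move=> urs AE rsS; rewrite -big_enum -(big_map (@perm_pair k l) xpredT F) /=.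
apply/perm_big/uniq_perm => //.
  by rewrite map_inj_uniq ?enum_uniq //; apply: perm_pair_inj.
move=> r; apply/mapP/idP => [[s + ->]|rin]; first by rewrite mem_enum AE.
have := rsS _ rin; rewrite mem_shufs => /is_shuf_onto[s _ rE].
by exists s; rewrite // mem_enum AE -rE.
Qed.

(** The position of 1 tells the two forms of a shuffle apart: index 0 for [prec_cons], k+1 for
    [succ_cons]. *)
Lemma mem_prec_shufs k l r : (r \in map prec_cons (shufs k l.+1)) =
  is_shuf k.+1 l.+1 r && (index 1%N (r.1 ++ r.2) == 0%N).
Proof.
apply/mapP/andP => [[r' + ->]|[rs r1]]; first by rewrite is_shuf_prec mem_shufs.
have [r' [] rE] := is_shufP rs; move: rs r1; rewrite rE.
  by rewrite is_shuf_prec -mem_shufs; exists r'.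
rewrite is_shuf_succ => /is_shuf_blocks[sr r0 _].
by rewrite index1_succ // sr.
Qed.

Lemma mem_succ_shufs k l r : (r \in map succ_cons (shufs k.+1 l)) =
  is_shuf k.+1 l.+1 r && (index 1%N (r.1 ++ r.2) == k.+1).
Proof.
apply/mapP/andP => [[r' + ->]|[rs r1]].
  rewrite is_shuf_succ mem_shufs => rs; split=> //.
  by have [sr r0 _] := is_shuf_blocks rs; rewrite index1_succ // sr.
have [r' [] rE] := is_shufP rs; move: rs r1; rewrite rE //.
by rewrite is_shuf_succ -mem_shufs; exists r'.
Qed.

Lemma mem_sh_prec k l (s : 'S_(k.+1 + l.+1)) :
  (s \in sh_prec k l) = (perm_pair s \in map prec_cons (shufs k l.+1)).
Proof.
rewrite mem_prec_shufs inE mem_sh perm_pair_cat; congr (_ && _).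
by rewrite -val_eqE /= -(perm_word_index s ord0).
Qed.

Lemma mem_sh_succ k l (s : 'S_(k.+1 + l.+1)) :
  (s \in sh_succ k l) = (perm_pair s \in map succ_cons (shufs k.+1 l)).
Proof.
rewrite mem_succ_shufs inE mem_sh perm_pair_cat; congr (_ && _).
by rewrite -val_eqE /= addn0 -(perm_word_index s ord0).
Qed.

(** * From tuples to sequences, and the two formulas *)

Lemma take_tnth T n m (t : (n + m).-tuple T) :
  take n t = [seq tnth t (lshift m i) | i <- enum 'I_n].
Proof.
rewrite {1}[t]tuple_map_ord /= enum_lrshift map_cat.
rewrite -(map_comp _ (@lshift n m)) -(map_comp _ (@rshift n m)).
by rewrite take_size_cat // size_map size_enum_ord.
Qed.

Lemma drop_tnth T n m (t : (n + m).-tuple T) :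
  drop n t = [seq tnth t (rshift n i) | i <- enum 'I_m].
Proof.
rewrite {1}[t]tuple_map_ord /= enum_lrshift map_cat.
rewrite -(map_comp _ (@lshift n m)) -(map_comp _ (@rshift n m)).
by rewrite drop_size_cat // size_map size_enum_ord.
Qed.

Lemma tword_lword (K : fieldType) (V : lmodType K) (Omega : choiceType) n
    (a : n.-tuple Omega) (v : n.+1.-tuple V) : tword a v = shword (lword a v).
Proof. by rewrite /tword /lword (tnth_nth 0) -nth_last size_tuple. Qed.

Lemma letters_perm_word (K : fieldType) (V : lmodType K) n (s : 'S_n)
    (v : n.-tuple V) :
  letters v (perm_word s) = [seq tnth v ((s^-1)%g i) | i <- enum 'I_n].
Proof.
rewrite /letters size_map size_enum_ord (iotaDl 1 0) -val_enum_ord.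
rewrite -(map_comp _ val) -map_comp; apply: eq_map => i /=.
by rewrite add1n perm_word_index -tnth_nth.
Qed.

(* The integers k, l >= 1 are written k.+1 and l.+1; alpha lists
   (alpha_2, ..., alpha_{k+l}) and v lists (v_1, ..., v_{k+l}). *)
Theorem proposition36 (K : fieldType) (V : lmodType K) (Omega : edsType)
    (k l : nat) (alpha : (k + l.+1).-tuple Omega)
    (v : (k.+1 + l.+1).-tuple V) :
  let x := tword [tuple tnth alpha (lshift l.+1 i) | i < k]
                 [tuple tnth v (lshift l.+1 i) | i < k.+1] in
  let a := tnth alpha (rshift k ord0) in
  let y := tword [tuple tnth alpha (rshift k (lift ord0 i)) | i < l]
                 [tuple tnth v (rshift k.+1 i) | i < l.+1] in
  shprec a x y =
    \sum_(s in sh_prec k l)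
      tword (Dmap s alpha) [tuple tnth v ((s^-1)%g i) | i < k.+1 + l.+1]
  /\
  shsucc a x y =
    \sum_(s in sh_succ k l)
      tword (Dmap s alpha) [tuple tnth v ((s^-1)%g i) | i < k.+1 + l.+1].
Proof.
move=> x a y; pose aL := take k alpha; pose aR := drop k.+1 alpha.
have saL : size aL = k by rewrite size_takel // size_tuple leq_addr.
have saR : size aR = l by rewrite size_drop size_tuple addnS subSS addKn.
(* [lift ord0] skips alpha_(k+1), the type of the product, so the remaining types begin at
   [drop k.+1]. *)
have aRE : aR = [seq tnth alpha (rshift k (lift ord0 i)) | i <- enum 'I_l].
  by rewrite /aR -addn1 addnC -drop_drop drop_tnth enum_ordSl /= drop0 -map_comp.
have xE : x = shword (lword aL (take k.+1 v)).
  by rewrite /x tword_lword /= /aL !take_tnth.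
have yE : y = shword (lword aR (drop k.+1 v)).
  by rewrite /y tword_lword /= aRE drop_tnth.
(* [Dmap] is by definition [Dword] on this splitting of [alpha], and the word of [s] is the
   concatenation of its blocks. *)
have sumE s : tword (Dmap s alpha) [tuple tnth v ((s^-1)%g i) | i < k.+1 + l.+1] =
    shuf_term aL a aR v (perm_pair s).
  by rewrite tword_lword /= -letters_perm_word -(perm_pair_cat s).
have [|| preE sucE] := @wprod_shufs K V Omega aL a aR (take k.+1 v) (drop k.+1 v).
- by rewrite saL size_takel // size_tuple leq_addr.
- by rewrite saR size_drop size_tuple addKn.
rewrite saL saR cat_take_drop in preE sucE.
rewrite xE yE shprec_word shsucc_word preE sucE.
(* [perm_pair] carries [sh_prec] and [sh_succ] onto the two halves of the enumeration. *)
split; under [RHS]eq_bigr => s _ do rewrite sumE; symmetry; apply: sum_perm_pair.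
- by rewrite (map_inj_uniq prec_cons_inj) shufs_uniq.
- exact: mem_sh_prec.
- by move=> r; rewrite mem_prec_shufs mem_shufs => /andP[].
- by rewrite (map_inj_uniq succ_cons_inj) shufs_uniq.
- exact: mem_sh_succ.
- by move=> r; rewrite mem_succ_shufs mem_shufs => /andP[].
Qed.
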